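(* For every function $x\in L_1[0,1]$ there exists $f\in L_1[0,1]$ such that $$|f|\leq 3\,\sigma_4\mu(x)\quad\text{and}\quad \sigma_{\frac18}S\mu(x)\leq 12\,\mu(Tf).$$
   Context: All functions are real-valued measurable functions on $[0,1]$ with Lebesgue measure $m$, identified when equal a.e.; inequalities between functions are pointwise a.e. Decreasing rearrangement: $\mu(x)=\mu(\cdot;x)$, $\mu(t;x):=\inf\{s\ge 0: m(\{u:|x(u)|>s\})\le t\}$, $t\in(0,1)$. Dilation operator: for $s>0$, $(\sigma_s x)(t)=x(t/s)\chi_{[0,1]}(t/s)$, $t\in[0,1]$ (so it is $0$ where $t/s>1$). Calderón operator: $(Sx)(t)=\frac1t\int_0^t x(s)\,ds+\int_t^1\frac{x(s)}{s}\,ds$, $x\in L_1[0,1]$. Martingale transform $T$: let $\mathcal{F}_n$, $n\ge0$, be the standard dyadic filtration on $[0,1]$ ($\mathcal F_n$ is generated by the intervals $((j-1)2^{-n},j2^{-n})$, $1\le j\le 2^n$), let $\mathbb{E}_n$ be the conditional expectation from $L_1$ onto $\mathcal F_n$, and $\mathbb E_{-1}=0$. Then $Tf=\sum_{m\ge0}(\mathbb{E}_{2m}f-\mathbb{E}_{2m-1}f)$ for $f\in L_1$, with convergence in measure. *)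

(* Defs.v *)
From HB Require Import structures.
From mathcomp Require Import all_boot all_order all_algebra.
From mathcomp Require Import all_classical all_reals all_analysis.

Set Implicit Arguments.
Unset Strict Implicit.
Unset Printing Implicit Defensive.

Import Order.TTheory GRing.Theory Num.Theory.
Import numFieldNormedType.Exports.

Local Open Scope classical_set_scope.
Local Open Scope ring_scope.

(* A function on [0,1] is represented by a total function R -> R; everything
   below depends only on its restriction to [0,1], up to null sets. *)

Definition L1 (R : realType) (x : R -> R) : Prop :=
  (@lebesgue_measure R).-integrable `[0, 1] (EFin \o x).

Definition ae_le (R : realType) (x y : R -> R) : Prop :=
  {ae @lebesgue_measure R, forall t, t \in `[0, 1] -> x t <= y t}.

(* [inf] is the infimum in R. For 0 < t and x finite-valued and measurable on
   [0,1] the set is nonempty, so the infimum is the genuine one. *)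
Definition rearrangement (R : realType) (x : R -> R) (t : R) : R :=
  inf [set s : R | 0 <= s /\
    (lebesgue_measure (`[0%R, 1%R] `&` [set u | (s < `|x u|)%R]) <= t%:E)%E].

Definition dilation (R : realType) (s : R) (x : R -> R) (t : R) : R :=
  x (t / s) * \1_(`[0, 1]%classic) (t / s).

Definition calderon (R : realType) (x : R -> R) (t : R) : R :=
  t^-1 * (\int[lebesgue_measure]_(s in `[0, t]) x s)
  + \int[lebesgue_measure]_(s in `[t, 1]) (x s / s).

Definition dyadic_intervals (R : realType) (n : nat) : set (set R) :=
  [set I | exists2 j : nat, (1 <= j <= 2 ^ n)%N &
    I = `](j%:R - 1) / 2 ^+ n, j%:R / 2 ^+ n[%classic].

Definition dyadic_filtration (R : realType) (n : nat) : set (set R) :=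
  <<s `[0, 1], @dyadic_intervals R n >>.

(* y is a version of the conditional expectation of x given the
   sigma-algebra F on [0,1]. *)
Definition is_cond_exp (R : realType) (F : set (set R)) (x y : R -> R) : Prop :=
  [/\ L1 y,
      forall B : set R, measurable B -> F (`[0, 1] `&` y @^-1` B) &
      forall A : set R, F A ->
        \int[lebesgue_measure]_(t in A) y t
        = \int[lebesgue_measure]_(t in A) x t].

Definition cvg_in_measure (R : realType) (u : nat -> R -> R) (g : R -> R) :
    Prop :=
  forall e : R, 0 < e ->
    (fun N : nat => lebesgue_measure
       (`[0%R, 1%R] `&` [set t | (e <= `|u N t - g t|)%R])) @ \oo --> 0%E.

(* [shifted E k] stands for E_{k-1}, with E_{-1} = 0. *)
Definition shifted (R : realType) (E : nat -> R -> R) (k : nat) : R -> R :=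
  if k is k'.+1 then E k' else cst 0.

(* g is a version of Tf. A relation is used because conditional expectations
   and limits in measure are only determined almost everywhere. *)
Definition is_martingale_transform (R : realType) (f g : R -> R) : Prop :=
  measurable_fun (`[0, 1] : set R) g /\
  exists E : nat -> R -> R,
    (forall n, is_cond_exp (@dyadic_filtration R n) f (E n)) /\
    cvg_in_measure
      (fun N t => \sum_(0 <= m < N) (E m.*2 t - shifted E m.*2 t)) g.

(* Main.v *)
Require Import Defs.
From HB Require Import structures.
From mathcomp Require Import all_boot all_order all_algebra.
From mathcomp Require Import all_classical all_reals all_analysis.
From mathcomp Require Import measurable_realfun.
From mathcomp Require Import ring lra zify.
Import Order.TTheory GRing.Theory Num.Theory.
Import numFieldNormedType.Exports.
Local Open Scope classical_set_scope.
Local Open Scope ring_scope.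

(** Write y for the decreasing rearrangement of x.  The function f is constant
on each dyadic shell ]2^-(j+1), 2^-j]: it equals 3 y(2^-(j+2)) there when j is
even and 0 when j is odd.  On such a shell t/4 <= 2^-(j+2), so that
0 <= f(t) <= 3 y(t/4), and f is integrable because
sum_k 2^-k y(2^-k) <= 4 ||x||_1 ([rearrangement_summable]).

For such a function the martingale is explicit.  With A_n the mean of f over
[0, 2^-n], the conditional expectation E_n f is almost everywhere equal to A_n
on ]0, 2^-n[ and to f outside it ([is_cond_exp_step_cond]).  Hence, on the
shell number l, the differences E_{2m} f - E_{2m-1} f vanish for m > l, and Tf
is again constant on the shells ([is_martingale_transform_step]).  As A_{2m-1}
is the average of f on the shell 2m-1, which is 0, and of A_{2m}, the difference
is A_{2m} / 2 whenever 1 <= m <= l/2.  The even differences thus do not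
telescope: on the shell l = 2p, Tf is at least (1/2) sum_{m <= p} A_{2m}
([transform_coef_even]), and this bounds the rearrangement of Tf from below on
]0, 2^-(2p+1)[ ([rearrangement_step_lb]).

It remains to bound Sy by the same sum ([calderon_le]).  Let
4^-(r+1) <= s <= 4^-r.  The Hardy mean of y over [0, s] is at most 4 times its
mean over [0, 4^-r], which is at most A_{2r} / 2 ([dyadic_mean_majorant]); the
tail integral over [s, 1] of y(u)/u is at most sum_{j < 2(r+1)} y(2^-(j+1))
([calderon_tail_le]), and 3 y(2^-(2q+2)) <= 2 A_{2q}.  Altogether
Sy(s) <= 4 sum_{q <= r} A_{2q}.  With s = 8 t, where t is not a dyadic rational,
t < 2^-(2(r+1)+1), so the lower bound on Tf applies with p = r + 1 and gives
Sy(8t) <= 8 mu(t; Tf). *)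

Set Implicit Arguments.
Unset Strict Implicit.
Unset Printing Implicit Defensive.

(** * Dyadic shells and step functions *)

Lemma pow2N_gt0 (R : realType) (j : nat) : 0 < 2 ^- j :> R.
Proof. by rewrite invr_gt0 exprn_gt0. Qed.

Lemma pow2NS (R : realType) (j : nat) : 2 ^- j = 2 * 2 ^- j.+1 :> R.
Proof. by rewrite exprS invfM mulrA divff ?mul1r// pnatr_eq0. Qed.

Lemma ler_pow2N (R : realType) (i j : nat) :
  (2 ^- j <= 2 ^- i :> R) = (i <= j)%N.
Proof. by rewrite lef_pV2 ?posrE ?exprn_gt0// ler_eXn2l// ltr1n. Qed.

Lemma ltr_pow2N (R : realType) (i j : nat) :
  (2 ^- j < 2 ^- i :> R) = (i < j)%N.
Proof. by rewrite ltNge ler_pow2N -ltnNge. Qed.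

Lemma pow2N_cvg0 (R : realType) : (fun j => 2 ^- j : R) @ \oo --> (0 : R).
Proof.
have := @cvg_geometric R 1 (2^-1).
rewrite ger0_norm ?invr_ge0// invf_lt1// ltr1n => /(_ isT).
by apply: cvg_trans; apply: near_eq_cvg; near=> n; rewrite /= mul1r exprVn.
Unshelve. all: by end_near. Qed.

Lemma pow2N_lt (R : realType) (e : R) : 0 < e -> exists n, 2 ^- n < e.
Proof.
move=> e0; have /cvgrPdist_lt/(_ e e0)[n _ /(_ n (leqnn n))] := @pow2N_cvg0 R.
by rewrite sub0r normrN gtr0_norm ?pow2N_gt0//; exists n.
Qed.

(** The dyadic shell number j, half-open so that the shells partition ]0, 1]. *)
Definition cell (R : realType) (j : nat) : set R :=
  `]2 ^- j.+1, 2 ^- j]%classic.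
Arguments cell : clear implicits.

Lemma cellE (R : realType) (j : nat) (t : R) :
  cell R j t = (2 ^- j.+1 < t) && (t <= 2 ^- j) :> Prop.
Proof. by rewrite /cell /= in_itv. Qed.

Lemma cell_gt0 (R : realType) (j : nat) (t : R) : cell R j t -> 0 < t.
Proof. by rewrite cellE => /andP[+ _]; apply: lt_trans; exact: pow2N_gt0. Qed.

Lemma cell_le (R : realType) (j n : nat) (t : R) : cell R j t ->
  (t <= 2 ^- n) = (n <= j)%N.
Proof.
rewrite cellE => /andP[jt tj]; apply/idP/idP => [tn|nj].
  by rewrite -ltnS -(ltr_pow2N R) (lt_le_trans jt).
by rewrite (le_trans tj)// ler_pow2N.
Qed.

Lemma cell_inj (R : realType) (i j : nat) (t : R) :
  cell R i t -> cell R j t -> i = j.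
Proof.
move=> it jt; apply/eqP; rewrite eqn_leq -(cell_le i jt) -(cell_le j it).
by move: it jt; rewrite !cellE => /andP[_ ->] /andP[_ ->].
Qed.

Lemma trivIset_cell (R : realType) (n : nat) :
  trivIset setT (fun j => cell R (n + j)).
Proof.
apply/trivIsetP => i j _ _ ij; rewrite -subset0 => t [it jt].
by move: ij; rewrite -(eqn_add2l n) (cell_inj it jt) eqxx.
Qed.

Lemma measurable_cell (R : realType) (j : nat) : measurable (cell R j).
Proof. exact: measurable_itv. Qed.

Lemma bigcup_cell (R : realType) (n : nat) :
  \bigcup_j cell R (n + j) = `]0, 2 ^- n]%classic.
Proof.
apply/seteqP; split=> t /=.
  move=> [j _ jt]; rewrite in_itv/= (cell_gt0 jt).
  by rewrite (cell_le _ jt) leq_addr.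
rewrite in_itv/= => /andP[t0 tn].
have [k kt] := pow2N_lt t0.
have exk : exists k, 2 ^- k < t by exists k.
case: (ex_minnP exk) => m mt min.
have nm : (n < m)%N by rewrite -(ltr_pow2N R) (lt_le_trans mt).
exists (m.-1 - n)%N => //; rewrite cellE.
have -> : (n + (m.-1 - n) = m.-1)%N by lia.
have -> : m.-1.+1 = m by lia.
rewrite mt/= leNgt; apply/negP => /min; lia.
Qed.

Lemma cell_exists (R : realType) (t : R) : 0 < t -> t <= 1 ->
  exists j, cell R j t.
Proof.
move=> t0 t1; have : `]0, 2 ^- 0]%classic t by rewrite /= in_itv/= t0 expr0 invr1.
by rewrite -bigcup_cell => -[j _]; exists j.
Qed.

(** The number of the shell containing t, for t in ]0, 1]; it is 0 when no shell
contains t. *)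
Definition level (R : realType) (t : R) : nat :=
  xget 0%N [set j | cell R j t].

Lemma level_cell (R : realType) (j : nat) (t : R) :
  cell R j t -> level t = j.
Proof.
rewrite /level => jt; case: xgetP => [i _ it|/(_ j)//].
exact: cell_inj it jt.
Qed.

(** The function with value b j on the shell number j.  The value at 0 and below
is 0; the values above 1 are irrelevant. *)
Definition step (R : realType) (b : nat -> R) (t : R) : R :=
  if 0 < t then b (level t) else 0.

Lemma step_cell (R : realType) (b : nat -> R) (j : nat) (t : R) :
  cell R j t -> step b t = b j.
Proof. by move=> jt; rewrite /step (cell_gt0 jt) (level_cell jt). Qed.

Lemma step_ge0 (R : realType) (b : nat -> R) (t : R) :
  (forall j, 0 <= b j) -> 0 <= step b t.
Proof. by rewrite /step; case: ifP. Qed.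

Lemma itvcc_setU (R : realType) (a : R) : 0 <= a ->
  `[0, a]%classic = [set 0] `|` `]0, a]%classic.
Proof.
move=> a0; apply/seteqP; split=> t /=; rewrite !in_itv/=.
  by rewrite le_eqVlt => /andP[/predU1P[<-|->] ta]; [left|right].
by move=> [->|/andP[/ltW-> ->]]//; rewrite lexx.
Qed.

Lemma measurable_fun_itvcc (R : realType) (a : R) (f : R -> R) :
  measurable_fun `]0, a] f -> measurable_fun `[0, a] f.
Proof.
move=> mf; have [a0|a0] := leP 0 a.
  rewrite itvcc_setU//; apply/measurable_funU;
    [exact: measurable_set1|exact: measurable_itv|].
  by split=> //; exact: measurable_fun_set1.
by rewrite set_itv_ge ?bnd_simp -?ltNge//; exact: measurable_fun_set0.
Qed.

Lemma measurable_step_oc (R : realType) (b : nat -> R) (n : nat) :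
  measurable_fun (`]0, 2 ^- n] : set R) (step b).
Proof.
rewrite -bigcup_cell.
apply/measurable_fun_bigcup => [j|j]; first exact: measurable_cell.
apply: (eq_measurable_fun (cst (b (n + j)%N))); last exact: measurable_cst.
by move=> t /set_mem jt; rewrite (step_cell _ jt).
Qed.

Lemma measurable_step (R : realType) (b : nat -> R) (n : nat) :
  measurable_fun (`[0, 2 ^- n] : set R) (step b).
Proof. by apply: measurable_fun_itvcc; exact: measurable_step_oc. Qed.

Lemma integral_step (R : realType) (b : nat -> R) (n : nat) :
  (forall j, 0 <= b j) ->
  (\int[lebesgue_measure]_(t in `[0%R, (2 ^- n)%R]) (step b t)%:E =
   \sum_(j <oo) (b (n + j)%N * 2 ^- (n + j).+1)%:E)%E.
Proof.
move=> b0; rewrite -integral_itv_obnd_cbnd; last first.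
  by apply/measurable_EFinP; exact: measurable_step_oc.
rewrite -bigcup_cell ge0_integral_bigcup//=; first last.
- exact: trivIset_cell.

- by move=> t _; rewrite lee_fin step_ge0.
- by apply/measurable_EFinP; rewrite bigcup_cell; exact: measurable_step_oc.
- by move=> k; exact: measurable_cell.
apply: eq_eseriesr => j _.

rewrite (eq_integral (cst (b (n + j)%N)%:E)); last first.
  by move=> t /set_mem jt; rewrite (step_cell _ jt).
rewrite integral_cst/=; last exact: measurable_cell.
rewrite /cell lebesgue_measure_itv/= lte_fin ltr_pow2N ltnSn -EFinD -EFinM.
by congr (_ * _)%:E; have := pow2NS R (n + j); lra.
Qed.

(** * The decreasing rearrangement *)

Lemma measurable_superlevel (R : realType) (x : R -> R) (s : R) :
  measurable_fun (`[0, 1] : set R) x ->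
  measurable (`[0, 1] `&` [set u | s < `|x u|] : set R).
Proof.
move=> mx; have -> : (`[0, 1] `&` [set u | s < `|x u|] : set R) =
    `[0, 1] `&` (Num.norm \o x) @^-1` `]s, +oo[%classic.
  by apply: eq_set => u; rewrite /= ![_ \in _]in_itv/= andbT.
by apply: measurableT_comp.
Qed.

Lemma rearrangement_ge0 (R : realType) (x : R -> R) (t : R) :
  0 <= rearrangement x t.
Proof.
rewrite /rearrangement; set E := mkset _.
have [->|/set0P E0] := eqVneq E set0; first by rewrite inf0.
by apply: lb_le_inf => // s [].
Qed.

(** Below the rearrangement at t, the distribution function exceeds t. *)
Lemma lt_rearrangement (R : realType) (x : R -> R) (t s : R) :
  0 <= s -> s < rearrangement x t ->
  (t%:E < lebesgue_measure (`[0%R, 1%R] `&` [set u | (s < `|x u|)%R]))%E.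
Proof.
move=> s0; apply: contraPT; rewrite -leNgt => xs; apply/negP; rewrite -leNgt.
by apply: ge_inf => //; exists 0 => r [].
Qed.

(** The superlevel sets of a real-valued measurable function decrease to the empty
set, so the infimum defining the rearrangement at t > 0 is over a nonempty set. *)
Lemma rearrangement_set_neq0 (R : realType) (x : R -> R) (t : R) : 0 < t ->
  measurable_fun (`[0, 1] : set R) x ->
  [set s : R | 0 <= s /\
    (lebesgue_measure (`[0%R, 1%R] `&` [set u | (s < `|x u|)%R]) <= t%:E)%E]
    !=set0.
Proof.
move=> t0 mx.
pose F n : set R := `[0, 1] `&` [set u | n%:R < `|x u|].
have mF n : measurable (F n) by exact: measurable_superlevel.
have F0 : \bigcap_n F n = set0.
  rewrite -subset0 => u Fu; have [_ /=] := Fu (Num.truncn `|x u|).+1 I.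
  by rewrite ltNge ltW// truncnS_gt.
have muF0 : (lebesgue_measure (F 0%N) < +oo)%E.
  apply: (@le_lt_trans _ _ (lebesgue_measure (`[0%R, 1%R] : set R))).
    by apply: le_measure; rewrite ?inE; [exact: mF|exact: measurable_itv|move=> u []].
  by rewrite lebesgue_measure_itv/= lte_fin ltr01 -EFinB ltry.
have cF : (fun n => lebesgue_measure (F n)) @ \oo --> 0%E.
  rewrite -(@measure0 _ _ _ (@lebesgue_measure R)) -F0.
  apply: nonincreasing_cvg_mu => //; first by rewrite F0.
  move=> m n mn; apply/subsetPset => u [u1 /= nu]; split => //=.
  by rewrite (le_lt_trans _ nu)// ler_nat.
have /cF[n _ /(_ n (leqnn n))/= Fn] : nbhs 0%E [set y : \bar R | (y < t%:E)%E].
  by apply: open_ereal_lt'; rewrite lte_fin.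
by exists n%:R; split => //; exact: ltW.
Qed.

(** Conversely to [lt_rearrangement], lower bounds on the distribution function
give a lower bound on the rearrangement. *)
Lemma rearrangement_lb (R : realType) (x : R -> R) (t a : R) : 0 < t ->
  measurable_fun (`[0, 1] : set R) x ->
  (forall s, 0 <= s -> s < a ->
    (t%:E < lebesgue_measure (`[0%R, 1%R] `&` [set u | (s < `|x u|)%R]))%E) ->
  a <= rearrangement x t.
Proof.
move=> t0 mx xa; apply: lb_le_inf; first exact: rearrangement_set_neq0.
move=> s [s0 xs]; rewrite leNgt; apply/negP => /(xa s s0).
by rewrite ltNge xs.
Qed.

Lemma rearrangement_nonincreasing (R : realType) (x : R -> R) (s t : R) :
  measurable_fun (`[0, 1] : set R) x -> 0 < s -> s <= t ->
  rearrangement x t <= rearrangement x s.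
Proof.
move=> mx s0 st; apply: rearrangement_lb => // a a0 /(lt_rearrangement a0).
by apply: le_lt_trans; rewrite lee_fin.
Qed.

Lemma L1_measurable (R : realType) (x : R -> R) : L1 x ->
  measurable_fun (`[0, 1] : set R) x.
Proof. by move=> /integrableP[/measurable_EFinP]. Qed.

(** The rearrangement of an integrable function is integrable, in a discrete form.
With y_k the rearrangement at 2^-k, the set where 2 |x| > y_k has measure at
least 2^-k unless y_k = 0, and the sum over k of y_k - y_{k-1} (y_{-1} = 0)
times its indicator is at most 2 |x|; integrate, then sum by parts. *)
Lemma rearrangement_summable (R : realType) (x : R -> R) : L1 x ->
  exists M, forall N, \sum_(k < N) rearrangement x (2 ^- k) * 2 ^- k <= M.
Proof.
move=> x1; have mx := L1_measurable x1.
pose y k := rearrangement x (2 ^- k).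
pose yp k := if k is k'.+1 then y k' else 0.
pose S k : set R := `[0, 1] `&` [set u | y k / 2 < `|x u|].
have y0 k : 0 <= y k by exact: rearrangement_ge0.
have yp0 k : 0 <= yp k by case: k.
have ypy k : yp k <= y k.
  case: k => [|k]; first exact: y0.
  apply: rearrangement_nonincreasing; [exact: mx|exact: pow2N_gt0|].
  by rewrite ler_pow2N.
have mS k : measurable (S k) by exact: measurable_superlevel.
have mi k : measurable_fun (`[0, 1] : set R) (\1_(S k) : R -> R).
  exact: measurable_indic.
have pt N u : `[0, 1]%classic u ->
    \sum_(k < N) (y k - yp k) * \1_(S k) u <= Num.min (2 * `|x u|) (yp N).
  move=> u1; elim: N => [|N IH].
    by rewrite big_ord0 le_min yp0 andbT mulr_ge0 ?normr_ge0 ?ler0n.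
  rewrite big_ord_recr/= le_min.
  move: IH; rewrite le_min => /andP[IH1 IH2].
  rewrite indicE; have [/set_mem[_ /= yx]|_] := boolP (u \in S N).
    by rewrite mulr1; apply/andP; split; lra.
  by rewrite mulr0 addr0 IH1/=; exact: le_trans (ypy N).
(* summation by parts, using 2^-k - 2^-(k+1) = 2^-k / 2 *)
have abel N : \sum_(k < N) (y k - yp k) * 2 ^- k =
    2^-1 * (\sum_(k < N) y k * 2 ^- k) + yp N * 2 ^- N.
  elim: N => [|N IH]; first by rewrite !big_ord0 mulr0 mul0r add0r.
  rewrite !big_ord_recr/= IH (pow2NS R N); lra.
pose I := (\int[lebesgue_measure]_(u in `[0%R, 1%R]) `|(x u)%:E|)%E.
have Ioo : (I < +oo)%E by case/integrableP: x1.
have I0 : (0 <= I)%E by apply: integral_ge0.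
have Ifin : I \is a fin_num by rewrite ge0_fin_numE.
have bd N : \sum_(k < N) (y k - yp k) * 2 ^- k <= 2 * fine I.
  rewrite -lee_fin EFinM fineK//.
  rewrite -sumEFin -ge0_integralZl_EFin//; last first.
    by apply/measurable_EFinP; exact: measurableT_comp.
  apply: (@le_trans _ _ (\sum_(k < N)
    \int[lebesgue_measure]_(u in `[0%R, 1%R]) ((y k - yp k) * \1_(S k) u)%:E)%E).
    apply: lee_sum => k _.
    rewrite [leLHS]EFinM.
    have -> : (\int[lebesgue_measure]_(u in `[0%R, 1%R]) ((y k - yp k) * \1_(S k) u)%:E =
        (y k - yp k)%:E * \int[lebesgue_measure]_(u in `[0%R, 1%R]) (\1_(S k) u)%:E)%E.
      rewrite -ge0_integralZl_EFin//.
      - by apply/measurable_EFinP; exact: mi.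
      - by rewrite subr_ge0.
    rewrite integral_indic//; last exact: mS.
    have [yk0|yk0] := eqVneq (y k) 0.
      have -> : y k - yp k = 0.
        by apply/eqP; rewrite eq_le subr_ge0 ypy andbT subr_le0 yk0.
      by rewrite !mul0e.
    apply: lee_wpmul2l; first by rewrite lee_fin subr_ge0.
    rewrite setIidl; last by move=> u [].
    apply/ltW/lt_rearrangement; first by rewrite divr_ge0.
    rewrite -/(y k). have : 0 < y k by rewrite lt_neqAle eq_sym yk0 y0.
    by move=> h; lra.
  rewrite -ge0_integral_sum//=; last 2 first.
  - move=> k; apply/measurable_EFinP; apply: measurable_funM => //; exact: mi.
  - by move=> k u _; rewrite lee_fin mulr_ge0// subr_ge0.
  apply: ge0_le_integral => //=.
  - by move=> u _; apply: sume_ge0 => k _; rewrite lee_fin mulr_ge0// subr_ge0.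
  - apply: emeasurable_sum => k; apply/measurable_EFinP.
    by apply: measurable_funM => //; exact: mi.
  - apply/measurable_EFinP; apply: measurable_funM => //; exact: measurableT_comp.
  - move=> u u1; rewrite sumEFin lee_fin.
    by have := pt N u u1; rewrite le_min => /andP[].
exists (2 * (2 * fine I)) => N.
have := bd N; rewrite abel -/(y _) => b1.
have : 0 <= yp N * 2 ^- N by rewrite mulr_ge0// ltW ?pow2N_gt0.
rewrite -/y; lra.
Qed.

(** * Integrals of step functions *)

Lemma nneseries_ubound (R : realType) (u : nat -> R) (M : R) :
  (forall j, 0 <= u j) -> (forall N, \sum_(j < N) u j <= M) ->
  (\sum_(j <oo) (u j)%:E <= M%:E)%E.
Proof.
move=> u0 uM; apply: lime_le; first by apply: is_cvg_nneseries => j _ _; rewrite lee_fin.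
by apply: nearW => N; rewrite big_mkord sumEFin lee_fin.
Qed.

Lemma integrable_step (R : realType) (b : nat -> R) (M : R) :
  (forall j, 0 <= b j) -> (forall N, \sum_(j < N) b j * 2 ^- j.+1 <= M) ->
  L1 (step b).
Proof.
move=> b0 bM; apply/integrableP.
have e1 : `[0, 1]%classic = `[0, 2 ^- 0]%classic :> set R by rewrite expr0 invr1.
split; first by apply/measurable_EFinP; rewrite e1; exact: measurable_step.
apply: (@le_lt_trans _ _ M%:E); last exact: ltry.
under eq_integral do rewrite /= ger0_norm ?step_ge0//.
rewrite e1 integral_step//; apply: nneseries_ubound => // j.
by rewrite mulr_ge0// ltW ?pow2N_gt0.
Qed.

Lemma L1_itv (R : realType) (x : R -> R) (a b : R) : L1 x -> 0 <= a -> b <= 1 ->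
  (@lebesgue_measure R).-integrable `[a, b] (EFin \o x).
Proof.
move=> x1 a0 b1; apply: integrableS x1 => //; apply: subset_itvScc; by rewrite bnd_simp.
Qed.

Lemma pow2N_le1 (R : realType) (n : nat) : 2 ^- n <= 1 :> R.
Proof. by have := ler_pow2N R 0 n; rewrite expr0 invr1 => ->. Qed.

(** The integral of [step b] over [0, 2^-n]. *)
Definition step_integral (R : realType) (b : nat -> R) (n : nat) : R :=
  \int[lebesgue_measure]_(t in `[0, 2 ^- n]) step b t.

Lemma step_integral_ge0 (R : realType) (b : nat -> R) (n : nat) :
  (forall j, 0 <= b j) -> 0 <= step_integral b n.
Proof. by move=> b0; apply: Rintegral_ge0 => t _; exact: step_ge0. Qed.

Lemma step_integralS (R : realType) (b : nat -> R) (n : nat) : L1 (step b) ->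
  step_integral b n = b n * 2 ^- n.+1 + step_integral b n.+1.
Proof.
move=> b1; rewrite /step_integral.
have -> : (`[0, 2 ^- n]%classic : set R) = cell R n `|` `[0, 2 ^- n.+1]%classic.
  apply/seteqP; split=> t /=; rewrite cellE !in_itv/=.
    move=> /andP[t0 tn]; case: (leP t (2 ^- n.+1)) => ?; [right|left] => //.
    by rewrite t0.
  have := pow2NS R n; have := pow2N_gt0 R n.+1.
  by move=> ? ? [|] /andP[? ?]; apply/andP; split; lra.
rewrite Rintegral_setU//=.
- congr (_ + _); rewrite (@eq_Rintegral _ _ _ lebesgue_measure _ (cst (b n))).
    rewrite Rintegral_cst//=; last exact: measurable_cell.
    rewrite /cell lebesgue_measure_itv/= lte_fin ltr_pow2N ltnSn/=.
    by congr (_ * _); have := pow2NS R n; lra.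
  by move=> t /set_mem; exact: step_cell.
- exact: measurable_cell.
- apply: integrableS b1 => //; first by apply: measurableU => //; exact: measurable_cell.
  have := pow2N_le1 R n; have := pow2N_le1 R n.+1; have := pow2N_gt0 R n.+1.
  by move=> ? ? ? t /=; rewrite cellE !in_itv/= => -[|] /andP[? ?];
    apply/andP; split; lra.
- apply/disj_setPS => t /=; rewrite cellE in_itv/=.
  by move=> [/andP[? ?] /andP[_ ?]]; lra.
Qed.

Lemma step_integral_lb (R : realType) (b : nat -> R) (n k : nat) :
  L1 (step b) -> (forall j, 0 <= b j) ->
  \sum_(j < k) b (n + j)%N * 2 ^- (n + j).+1 <= step_integral b n.
Proof.
move=> b1 b0; suff -> : step_integral b n =
    \sum_(j < k) b (n + j)%N * 2 ^- (n + j).+1 + step_integral b (n + k).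
  by rewrite lerDl step_integral_ge0.
elim: k => [|k IH]; first by rewrite big_ord0 add0r addn0.
by rewrite big_ord_recr/= IH step_integralS// addrA addnS.
Qed.

Lemma step_integral_ub (R : realType) (b : nat -> R) (n : nat) (M : R) :
  (forall j, 0 <= b j) ->
  (forall k, \sum_(j < k) b (n + j)%N * 2 ^- (n + j).+1 <= M) ->
  step_integral b n <= M.
Proof.
move=> b0 bM; rewrite /step_integral /Rintegral integral_step//.
have u0 j : 0 <= b (n + j)%N * 2 ^- (n + j).+1.
  by rewrite mulr_ge0// ltW ?pow2N_gt0.
have := nneseries_ubound u0 bM.
have : (0 <= \sum_(j <oo) (b (n + j)%N * 2 ^- (n + j).+1)%:E)%E.
  by apply: nneseries_ge0 => j _ _; rewrite lee_fin.
by case: (limn _) => [r| |]//=; rewrite ?lee_fin.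
Qed.

(** The mean A_n of [step b] over [0, 2^-n]. *)
Definition dyadic_mean (R : realType) (b : nat -> R) (n : nat) : R :=
  2 ^+ n * step_integral b n.

Lemma dyadic_meanS (R : realType) (b : nat -> R) (n : nat) : L1 (step b) ->
  dyadic_mean b n = (b n + dyadic_mean b n.+1) / 2.
Proof.
move=> b1; rewrite /dyadic_mean step_integralS// exprS.
have : (2 ^+ n : R) != 0 by rewrite expf_neq0.
by move=> ?; field.
Qed.

Lemma dyadic_mean_ge0 (R : realType) (b : nat -> R) (n : nat) :
  (forall j, 0 <= b j) -> 0 <= dyadic_mean b n.
Proof. by move=> b0; rewrite mulr_ge0 ?step_integral_ge0// exprn_ge0. Qed.

(** Monotonicity is only required on the positive half-line, as f may be unbounded
near 0; on each shell f coincides with the monotone function obtained by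
stopping it at the left endpoint. *)
Lemma measurable_nonincreasing01 (R : realType) (f : R -> R) :
  (forall s t, 0 < s -> s <= t -> f t <= f s) ->
  measurable_fun (`[0, 1] : set R) f.
Proof.
move=> fmono; apply: measurable_fun_itvcc.
have -> : (`]0, 1]%classic : set R) = `]0, 2 ^- 0]%classic by rewrite expr0 invr1.
rewrite -bigcup_cell; apply/measurable_fun_bigcup => [j|j]; first exact: measurable_cell.
rewrite add0n; pose g (t : R) : R := f (Num.max t (2 ^- j.+1)).
apply: (eq_measurable_fun g) => [t|].
  move=> /set_mem; rewrite cellE => /andP[/ltW jt _].
  by rewrite /g max_l.
apply: nonincreasing_measurable; first exact: measurable_cell.
move=> s t st; apply: fmono; first by rewrite lt_max pow2N_gt0 orbT.
by rewrite ge_max !le_max st/= lexx orbT.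
Qed.

(** The value of f at a is irrelevant, so the comparison is only required on
]a, s]; this matters for a = 0. *)
Lemma Rintegral_le_step (R : realType) (f : R -> R) (b : nat -> R) (a s : R)
    (n : nat) : 0 <= a -> s <= 2 ^- n -> measurable_fun (`[0, 1] : set R) f ->
  L1 (step b) -> (forall j, 0 <= b j) ->
  (forall t, a < t -> t <= s -> 0 <= f t <= step b t) ->
  \int[lebesgue_measure]_(t in `[a, s]) f t <= step_integral b n.
Proof.
move=> a0 sn mf b1 b0 fb; have n1 := pow2N_le1 R n.
have sub1 : (`]a, s]%classic : set R) `<=` `[0, 1]%classic.
  by move=> t /=; rewrite !in_itv/= => /andP[? ?]; apply/andP; split; lra.
have sub2 : (`]a, s]%classic : set R) `<=` `[0, 2 ^- n]%classic.
  by move=> t /=; rewrite !in_itv/= => /andP[? ?]; apply/andP; split; lra.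
have fb' t : `]a, s]%classic t -> 0 <= f t <= step b t.
  by rewrite /= in_itv/= => /andP[? ?]; exact: fb.
have mf' : measurable_fun (`]a, s] : set R) f by exact: measurable_funS mf.
have ms : measurable_fun (`[0, 2 ^- n] : set R) (step b) by exact: measurable_step.
have le : (\int[lebesgue_measure]_(t in `[a, s]) (f t)%:E <=
    \int[lebesgue_measure]_(t in `[0%R, (2 ^- n)%R]) (step b t)%:E)%E.
  rewrite -integral_itv_obnd_cbnd; last exact/measurable_EFinP.
  apply: (@le_trans _ _ (\int[lebesgue_measure]_(t in `]a, s]) (step b t)%:E)%E).
    apply: ge0_le_integral => //=.
    - by move=> t /fb'/andP[? _]; rewrite lee_fin.
    - exact/measurable_EFinP.
    - by apply/measurable_EFinP; exact: measurable_funS ms.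
    - by move=> t /fb'/andP[_ ?]; rewrite lee_fin.
  apply: ge0_subset_integral => //=; first exact/measurable_EFinP.
  by move=> t _; rewrite lee_fin step_ge0.
have fin2 : (\int[lebesgue_measure]_(t in `[0%R, (2 ^- n)%R]) (step b t)%:E)%E \is a fin_num.
  by apply: integrable_fin_num => //; exact: L1_itv.
have ge0 : (0 <= \int[lebesgue_measure]_(t in `[a, s]) (f t)%:E)%E.
  rewrite -integral_itv_obnd_cbnd; last exact/measurable_EFinP.
  by apply: integral_ge0 => t /fb'/andP[? _]; rewrite lee_fin.
apply: fine_le => //.
by rewrite ge0_fin_numE// (le_lt_trans le)// ltey_eq fin2.
Qed.

(** * Dyadic conditional expectations and the martingale transform *)

(** The points k / 2^n with k a natural number; those of [0, 1] are the endpoints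
of the dyadic intervals of generation n. *)
Definition dyadic_points (R : realType) (n : nat) : set R :=
  [set t | exists k : nat, t = k%:R / 2 ^+ n].
Arguments dyadic_points : clear implicits.

(** The j-th open dyadic interval of generation n, for 1 <= j <= 2^n. *)
Definition dyadic_itv (R : realType) (n j : nat) : set R :=
  `](j%:R - 1) / 2 ^+ n, j%:R / 2 ^+ n[%classic.
Arguments dyadic_itv : clear implicits.

Lemma natr_predn (R : realType) (j : nat) : (0 < j)%N ->
  (j.-1)%:R = j%:R - 1 :> R.
Proof. by case: j => // j _; rewrite -natr1 addrK. Qed.

Lemma dyadic_itvE (R : realType) (n j : nat) (t : R) :
  dyadic_itv R n j t = (j%:R - 1 < t * 2 ^+ n) && (t * 2 ^+ n < j%:R) :> Prop.
Proof.
by rewrite /dyadic_itv /= in_itv/= ltr_pdivrMr ?exprn_gt0// ltr_pdivlMr ?exprn_gt0.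
Qed.

Lemma countable_dyadic_points (R : realType) :
  countable (\bigcup_n dyadic_points R n).
Proof.
apply: bigcup_countable => [|n _]; first exact: countableP.
have -> : dyadic_points R n = \bigcup_k [set k%:R / 2 ^+ n].
  by apply/seteqP; split => [t [k ->]|t [k _ ->]]; exists k.
by apply: bigcup_countable => [|k _]; [exact: countableP|exact: countable1].
Qed.

Lemma measurable_dyadic_points (R : realType) :
  measurable (\bigcup_n dyadic_points R n).
Proof.
apply: countable_measurable; last exact: countable_dyadic_points.
by move=> t; exact: measurable_set1.
Qed.

Lemma dyadic_itv_exists (R : realType) (n : nat) (t : R) : 0 <= t <= 1 ->
  ~ dyadic_points R n t -> exists2 j, (1 <= j <= 2 ^ n)%N & dyadic_itv R n j t.
Proof.
move=> /andP[t0 t1] tn; have p0 : 0 < 2 ^+ n :> R by exact: exprn_gt0.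
have t0' : 0 <= t * 2 ^+ n by rewrite mulr_ge0// ltW.
have /andP[kt tk] := truncn_itv t0'.
set k := Num.truncn _ in kt tk.
have kt' : k%:R < t * 2 ^+ n.
  rewrite lt_neqAle kt andbT; apply/eqP => e; apply: tn; exists k.
  by rewrite e mulfK// gt_eqF.
exists k.+1; last by rewrite dyadic_itvE tk andbT -natr1 addrK.
rewrite /= -(ltr_nat R) natrX (lt_le_trans kt')// ler_piMl// ltW//.
Qed.

Lemma dyadic_itvN (R : realType) (n j : nat) (t : R) : (1 <= j)%N ->
  dyadic_itv R n j t -> ~ dyadic_points R n t.
Proof.
move=> j1; rewrite dyadic_itvE => /andP[jt tj] [k tk]; move: jt tj.
rewrite tk mulfVK ?expf_neq0// -natr_predn// !ltr_nat; lia.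
Qed.

Lemma dyadic_itv_sub01 (R : realType) (n j : nat) (t : R) :
  (1 <= j <= 2 ^ n)%N -> dyadic_itv R n j t -> 0 < t < 1.
Proof.
move=> /andP[j1 jn]; rewrite dyadic_itvE -natr_predn// => /andP[jt tj].
have p0 : 0 < 2 ^+ n :> R by exact: exprn_gt0.
rewrite -(pmulr_lgt0 t p0) (le_lt_trans _ jt)//=.
rewrite -(ltr_pM2r p0) mul1r (lt_le_trans tj)//.
by rewrite -natrX ler_nat.
Qed.

(** A dyadic interval of generation n that meets a shell of number l < n is
contained in it. *)
Lemma dyadic_itv_cell (R : realType) (n j l : nat) (u v : R) :
  (1 <= j)%N -> dyadic_itv R n j u -> dyadic_itv R n j v -> (l < n)%N ->
  cell R l u -> cell R l v.
Proof.
move=> j1; rewrite !dyadic_itvE -natr_predn// => /andP[ju uj] /andP[jv vj] ln.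
have p0 : 0 < 2 ^+ n :> R by exact: exprn_gt0.
have cellM t : cell R l t = (2 ^- l.+1 * 2 ^+ n < t * 2 ^+ n) &&
    (t * 2 ^+ n <= 2 ^- l * 2 ^+ n) :> Prop.
  by rewrite cellE ltr_pM2r// ler_pM2r.
rewrite !cellM; have e m : (m <= n)%N -> 2 ^- m * 2 ^+ n = (2 ^ (n - m))%:R :> R.
  move=> mn; rewrite natrX; apply: (@mulfI _ (2 ^+ m)); first by rewrite expf_neq0.
  by rewrite mulrA divff ?expf_neq0// mul1r -exprD subnKC.
rewrite !e ?(ltnW ln)// => /andP[lu ul]; apply/andP; split.
  rewrite (le_lt_trans _ jv)// ler_nat.
  by have := lt_trans lu uj; rewrite ltr_nat; lia.
rewrite (le_trans (ltW vj))// ler_nat.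
by have := lt_le_trans ju ul; rewrite ltr_nat; lia.
Qed.

(** The value on the shell number l of the n-th conditional expectation of
[step b]. *)
Definition cond_coef (R : realType) (b : nat -> R) (n l : nat) : R :=
  if (n <= l)%N then dyadic_mean b n else b l.

(** A version of the n-th dyadic conditional expectation of [step b].  The set of
endpoints is an atom of the sigma-algebra generated by the open dyadic
intervals, so the version has to be constant on it; the value chosen is 0. *)
Definition step_cond (R : realType) (b : nat -> R) (n : nat) (t : R) : R :=
  if `[< dyadic_points R n t >] then 0 else step (cond_coef b n) t.

Lemma step_condE (R : realType) (b : nat -> R) (n l : nat) (t : R) :
  ~ dyadic_points R n t -> cell R l t -> step_cond b n t = cond_coef b n l.
Proof. by move=> nt lt; rewrite /step_cond asboolF// (step_cell _ lt). Qed.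

Lemma step_cond_points (R : realType) (b : nat -> R) (n : nat) (t : R) :
  dyadic_points R n t -> step_cond b n t = 0.
Proof. by move=> nt; rewrite /step_cond asboolT. Qed.

Lemma step_cond_const (R : realType) (b : nat -> R) (n j : nat) (u v : R) :
  (1 <= j <= 2 ^ n)%N -> dyadic_itv R n j u -> dyadic_itv R n j v ->
  step_cond b n u = step_cond b n v.
Proof.
move=> j1 ju jv; have /andP[u0 /ltW u1] := dyadic_itv_sub01 j1 ju.
have /andP[v0 /ltW v1] := dyadic_itv_sub01 j1 jv; case/andP: j1 => j1 _.
have [l lu] := cell_exists u0 u1; have [m mv] := cell_exists v0 v1.
rewrite (step_condE b (dyadic_itvN j1 ju) lu) (step_condE b (dyadic_itvN j1 jv) mv).
rewrite /cond_coef; case: (leqP n l) => nl; case: (leqP n m) => nm //.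
- have /cell_inj/(_ lu) ml := dyadic_itv_cell j1 jv ju nm mv; lia.
- have /cell_inj/(_ mv) ml := dyadic_itv_cell j1 ju jv nl lu; lia.
- by have /cell_inj/(_ mv) <- := dyadic_itv_cell j1 ju jv nl lu.
Qed.

Lemma cond_coef_ge0 (R : realType) (b : nat -> R) (n l : nat) :
  (forall j, 0 <= b j) -> 0 <= cond_coef b n l.
Proof. by move=> b0; rewrite /cond_coef; case: ifP => // _; exact: dyadic_mean_ge0. Qed.

Lemma L1_step_cond_coef (R : realType) (b : nat -> R) (n : nat) :
  L1 (step b) -> (forall j, 0 <= b j) -> L1 (step (cond_coef b n)).
Proof.
move=> b1 b0.
apply: (@integrable_step _ _ (step_integral b 0 + dyadic_mean b n)).
  by move=> j; exact: cond_coef_ge0.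
move=> N; apply: (@le_trans _ _ (\sum_(j < N) (b j * 2 ^- j.+1) +
    \sum_(j < N) (dyadic_mean b n * 2 ^- j.+1))).
  rewrite -big_split/=; apply: ler_sum => j _.
  rewrite -mulrDl ler_pM2r ?pow2N_gt0// /cond_coef.
  by case: ifP => _; rewrite ?lerDl ?lerDr//; exact: dyadic_mean_ge0.
apply: lerD; first exact: (@step_integral_lb _ b 0 N).
rewrite -mulr_sumr ler_piMr ?dyadic_mean_ge0//.
suff -> : \sum_(j < N) 2 ^- j.+1 = 1 - 2 ^- N :> R.
  by rewrite gerBl ltW ?pow2N_gt0.
elim: N => [|N IH]; first by rewrite big_ord0 expr0 invr1 subrr.
by rewrite big_ord_recr/= IH; have := pow2NS R N; lra.
Qed.

(** Sets of the n-th dyadic sigma-algebra do not split the atom ]0, 2^-n[. *)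
Lemma dyadic_filtration_sub (R : realType) (n : nat) (A : set R) :
  @dyadic_filtration R n A ->
  [/\ measurable A, A `<=` `[0, 1]%classic &
    forall t u, 0 < t < 2 ^- n -> 0 < u < 2 ^- n -> A t -> A u].
Proof.
pose C : set (set R) := [set A : set R | [/\ measurable A, A `<=` `[0, 1]%classic &
    forall t u, 0 < t < 2 ^- n -> 0 < u < 2 ^- n -> A t -> A u]].
suff : @dyadic_filtration R n `<=` C by apply.
have n1 := pow2N_le1 R n.
apply: smallest_sub; first split.
- by split => //.
- move=> B [mB B1 BI]; split; first exact: measurableD.
  + by move=> t [].
  + move=> t u tn un [t1 tB]; split; last by move=> /(BI _ _ un tn).
    by move: un => /andP[? ?]; rewrite /= in_itv/=; apply/andP; split; lra.
- move=> B mB; split.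
  + by apply: bigcup_measurable => k _; case: (mB k).
  + by move=> t [k _]; case: (mB k) => _ + _; exact.
  + by move=> t u tn un [k _ kt]; exists k => //; case: (mB k) => _ _ /(_ t u tn un kt).
- move=> _ [j j1 ->]; split; first exact: measurable_itv.
  + move=> t /(dyadic_itv_sub01 j1)/andP[/ltW ? /ltW ?].
    by rewrite /= in_itv/=; apply/andP.
  + have p0 : 0 < 2 ^+ n :> R by exact: exprn_gt0.
    move=> t u; rewrite -[X in _ -> _ -> X -> _]/(dyadic_itv R n j t).
    rewrite -[X in _ -> _ -> _ -> X]/(dyadic_itv R n j u).
    rewrite -[2 ^- n]mul1r !ltr_pdivlMr// !dyadic_itvE.
    rewrite -(pmulr_lgt0 t p0) -(pmulr_lgt0 u p0).
    case/andP: j1 => j1 _; rewrite -natr_predn//.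
    move=> /andP[t0 t1] /andP[u0 u1] /andP[jt tj].
    have := lt_trans jt t1; rewrite -[1]/(1%:R) ltr_nat => ?.
    have -> : j = 1%N by lia.
    by rewrite u0.
Qed.

Lemma step_cond_preimage (R : realType) (b : nat -> R) (n : nat) (B : set R) :
  @dyadic_filtration R n (`[0, 1] `&` step_cond b n @^-1` B).
Proof.
pose J j := (1 <= j <= 2 ^ n)%N.
have [F0 FD FU] := @smallest_sigma_algebra _
  (`[0, 1]%classic : set R) (@dyadic_intervals R n).
(* the union of the dyadic intervals whose index satisfies P *)
pose U (P : nat -> Prop) := \bigcup_j
  (if `[< J j /\ P j >] then dyadic_itv R n j else set0).
have FUP P : @dyadic_filtration R n (U P).
  apply: FU => j; case: asboolP => [[Jj _]|_]; last exact: F0.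
  by apply: sub_sigma_algebra; exists j.
(* the preimage consists of the intervals that it meets, together with the set
   of endpoints when B contains the value 0 taken there *)
pose P j := dyadic_itv R n j `&` step_cond b n @^-1` B !=set0.
pose V := if `[< B 0 >] then `[0, 1]%classic `\` U xpredT else set0.
have FV : @dyadic_filtration R n V.
  by rewrite /V; case: ifP => _; [by apply: FD; exact: FUP|exact: F0].
suff -> : (`[0, 1] `&` step_cond b n @^-1` B) = U P `|` V.
  by rewrite -bigcup2E; apply: FU => -[|[|k]] /=; [exact: FUP|exact: FV|exact: F0].
apply/seteqP; split => t /=.
- rewrite in_itv/= => -[t01 Bt]; have [nt|nt] := pselect (dyadic_points R n t).
    right; rewrite /V asboolT; last by rewrite -(step_cond_points b nt).
    split; first by rewrite /= in_itv.
    move=> [j _]; case: asboolP => // -[/andP[j1 _] _] /(dyadic_itvN j1); exact.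
  have [j j1 jt] := dyadic_itv_exists t01 nt; left.
  by exists j => //; rewrite asboolT//; split => //; exists t.
- move=> [[j _]|].
    case: asboolP => // -[Jj [u [ju Bu]]] jt; split.
      have /andP[/ltW t0 /ltW t1] := dyadic_itv_sub01 Jj jt.
      by rewrite in_itv/= t0.
    by rewrite (step_cond_const b Jj jt ju).
  rewrite /V; case: asboolP => // B0 [t01 Ut]; split => //.
  rewrite step_cond_points//; apply: contrapT => nt; apply: Ut.
  move: t01; rewrite /= in_itv/= => t01.
  have [j j1 jt] := dyadic_itv_exists t01 nt.
  by exists j => //; rewrite asboolT.
Qed.

Lemma L1_step_cond (R : realType) (b : nat -> R) (n : nat) :
  L1 (step b) -> (forall j, 0 <= b j) -> L1 (step_cond b n).
Proof.
move=> b1 b0; apply: le_integrable (L1_step_cond_coef n b1 b0) => //.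
- apply/measurable_EFinP => _ B _.
  by have [] := dyadic_filtration_sub (@step_cond_preimage R b n B).
- move=> t _; rewrite /= lee_fin /step_cond; case: ifP => // _.
  by rewrite normr0.
Qed.

Lemma integral_dyadic_filtration_split (R : realType) (n : nat) (A : set R) (g : R -> R) :
  @dyadic_filtration R n A -> L1 g ->
  \int[lebesgue_measure]_(t in A) g t =
  \int[lebesgue_measure]_(t in A `\` `]0, 2 ^- n[) g t +
  \int[lebesgue_measure]_(t in A `&` `]0, 2 ^- n[) g t.
Proof.
move=> /dyadic_filtration_sub[mA A1 _] g1.
rewrite -[in LHS](setDUK (@subIsetl _ A `]0, 2 ^- n[%classic)).
rewrite setDIr setDv set0U setUC Rintegral_setU//.
- exact: measurableD.
- exact: measurableI.
- apply: integrableS g1 => //; first by apply: measurableU;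
    [exact: measurableD|exact: measurableI].
  by move=> t [[/A1]|[/A1]].
- by apply/disj_setPS => t [[_ +] [_]].
Qed.

Lemma is_cond_exp_step_cond (R : realType) (b : nat -> R) (n : nat) :
  L1 (step b) -> (forall j, 0 <= b j) ->
  is_cond_exp (@dyadic_filtration R n) (step b) (step_cond b n).
Proof.
move=> b1 b0; split; [exact: L1_step_cond|by move=> B _; exact: step_cond_preimage|].
move=> A FA; have [mA A1 AU] := dyadic_filtration_sub FA.
have e1 := L1_step_cond n b1 b0.
(* away from ]0, 2^-n[ both functions agree off the endpoints; the trace of A
   on ]0, 2^-n[ is empty or the whole interval *)
rewrite !(integral_dyadic_filtration_split FA)//; congr (_ + _).
- rewrite /Rintegral; congr fine; apply: ae_eq_integral.
  + exact: measurableD.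
  + apply/measurable_EFinP; apply: measurable_funS (L1_measurable e1) => //.
    by move=> t [/A1].
  + apply/measurable_EFinP; apply: measurable_funS (L1_measurable b1) => //.
    by move=> t [/A1].
  + exists (\bigcup_n dyadic_points R n); split.
    * exact: measurable_dyadic_points.
    * by apply: countable_lebesgue_measure0; exact: countable_dyadic_points.
    * move=> t /= tA; apply: contrapT => tQ; apply: tA => -[/A1].
      rewrite /= !in_itv/= => /andP[t0 t1] tU.
      have nt : ~ dyadic_points R n t by move=> nt; apply: tQ; exists n.
      have t0' : 0 < t.
        rewrite lt_neqAle t0 andbT; apply/eqP => t0'; apply: nt; exists 0%N.
        by rewrite -t0' mul0r.
      have tn : 2 ^- n < t.
        rewrite lt_neqAle; apply/andP; split; last first.
          by rewrite leNgt; apply/negP => tn; apply: tU; rewrite t0'.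
        by apply/eqP => tn; apply: nt; exists 1%N; rewrite mul1r.
      have [l lt] := cell_exists t0' t1.
      by rewrite (step_condE _ nt lt) (step_cell _ lt) /cond_coef -(cell_le _ lt) leNgt tn.
- have [A0|/eqP/set0P[t [At tU]]] := pselect (A `&` `]0, 2 ^- n[%classic = set0).
    by rewrite A0 !Rintegral_set0.
  have -> : A `&` `]0, 2 ^- n[ = `]0, 2 ^- n[%classic.
    apply: setIidr => u uU; move: tU uU; rewrite /= !in_itv/= => tU uU.
    exact: (AU t).
  rewrite (@eq_Rintegral _ _ _ _ _ (cst (dyadic_mean b n))).
    rewrite Rintegral_cst//= lebesgue_measure_itv/= lte_fin pow2N_gt0/= subr0.
    rewrite /dyadic_mean mulrC mulrA mulVf ?expf_neq0// mul1r /step_integral.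
    rewrite -Rintegral_itv_obnd_cbnd ?Rintegral_itv_bndo_bndc//.
      apply: integrableS b1 => // u; have := pow2N_le1 R n.
      by rewrite /= !in_itv/= => ? /andP[? ?]; apply/andP; split; lra.
    apply: integrableS b1 => // u; have := pow2N_le1 R n.
    by rewrite /= !in_itv/= => ? /andP[? ?]; apply/andP; split; lra.
  move=> u /set_mem; rewrite /= in_itv/= => /andP[u0 un].
  have [l lu] := cell_exists u0 (le_trans (ltW un) (pow2N_le1 R n)).
  have nu : ~ dyadic_points R n u.
    apply: (@dyadic_itvN _ _ 1) => //; rewrite dyadic_itvE subrr.
    rewrite mulr_gt0 ?exprn_gt0//=.
    by rewrite -ltr_pdivlMr ?exprn_gt0// mul1r.
  by rewrite (step_condE _ nu lu) /cond_coef -(cell_le _ lu) ltW.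
Qed.

(** The coefficients of the (n-1)-st conditional expectation, with the convention
that the one of index -1 is 0. *)
Definition pred_cond_coef (R : realType) (b : nat -> R) (n l : nat) : R :=
  if n is k.+1 then cond_coef b k l else 0.

(** The value of the martingale transform of [step b] on the shell number l.  The
sum stops at m = l because the later differences vanish there
([transform_coefE]). *)
Definition transform_coef (R : realType) (b : nat -> R) (l : nat) : R :=
  \sum_(0 <= m < l.+1) (cond_coef b m.*2 l - pred_cond_coef b m.*2 l).

Lemma transform_coefE (R : realType) (b : nat -> R) (l N : nat) :
  (l < N)%N ->
  \sum_(0 <= m < N) (cond_coef b m.*2 l - pred_cond_coef b m.*2 l) = transform_coef b l.
Proof.
move=> lN; rewrite (big_cat_nat (n := l.+1))//=.
rewrite [X in _ + X]big_nat_cond [X in _ + X]big1 ?addr0// => m.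
rewrite andbT => /andP[lm _]; rewrite /cond_coef.
have -> : m.*2 = (m.*2.-1).+1 by lia.
rewrite /= /cond_coef !ifN ?subrr//; lia.
Qed.

Lemma measurable_step01 (R : realType) (b : nat -> R) :
  measurable_fun (`[0, 1] : set R) (step b).
Proof.
by have := @measurable_step R b 0; rewrite expr0 invr1.
Qed.

(** The N-th partial sum of the transform agrees with its limit outside [0, 2^-N]
and the dyadic rationals, whence the convergence in measure. *)
Lemma is_martingale_transform_step (R : realType) (b : nat -> R) :
  L1 (step b) -> (forall j, 0 <= b j) ->
  is_martingale_transform (step b) (step (transform_coef b)).
Proof.
move=> b1 b0; split; first exact: measurable_step01.
exists (step_cond b); split; first by move=> n; exact: is_cond_exp_step_cond.
move=> e e0.
pose u N t := \sum_(0 <= m < N) (step_cond b m.*2 t - shifted (step_cond b) m.*2 t).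
have mu N : measurable_fun (`[0, 1] : set R) (u N).
  apply: measurable_sum => m; apply: measurable_funB.
    by apply: L1_measurable; exact: L1_step_cond.
  case: m.*2 => [|k] /=; first exact: measurable_cst.
  by apply: L1_measurable; exact: L1_step_cond.
pose Q := \bigcup_n dyadic_points R n.
have mQ : measurable Q by exact: measurable_dyadic_points.
have Q0 : lebesgue_measure Q = 0%E.
  by apply: countable_lebesgue_measure0; exact: countable_dyadic_points.
apply: (@squeeze_cvge _ _ _ _ (cst 0%E) _ (fun N => (2 ^- N)%:E)); last 2 first.
- exact: cvg_cst.
- by apply: cvg_EFin; [exact: nearW|exact: pow2N_cvg0].
apply: nearW => N; rewrite measure_ge0/=.
have mI : measurable (`[0, 2 ^- N]%classic : set R) by exact: measurable_itv.
apply: (@le_trans _ _ (lebesgue_measure (`[0, 2 ^- N]%classic `|` Q))).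
  apply: le_measure; rewrite ?inE.
  - have mh : measurable_fun (`[0, 1] : set R)
        (Num.norm \o (u N \- step (transform_coef b))).
      apply: measurableT_comp => //; apply: measurable_funB => //.
      exact: measurable_step01.
    have -> : `[0, 1] `&` [set t | e <= `|u N t - step (transform_coef b) t|] =
      `[0, 1] `&` (Num.norm \o (u N \- step (transform_coef b))) @^-1` `[e, +oo[%classic.
      by apply: eq_set => t; rewrite /= ![_ \in _]in_itv/= andbT.
    apply: mh => //; exact: measurable_itv.
  - exact: measurableU.
  - move=> t [/= t1]; rewrite leNgt => /negP ut; apply: contrapT => tn; apply: ut.
    have tQ n : ~ dyadic_points R n t by move=> nt; apply: tn; right; exists n.
    have tN : ~~ (t <= 2 ^- N).
      apply/negP => tN; apply: tn; left; move: t1; rewrite /= !in_itv/=.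
      by move=> /andP[-> _].
    have [t0 t1'] : 0 < t /\ t <= 1.
      move: t1 tN; rewrite in_itv/= -ltNge => /andP[_ ->] tN.
      by split => //; apply: lt_trans tN; exact: pow2N_gt0.
    have [l lt] := cell_exists t0 t1'; move: tN; rewrite (cell_le _ lt) -ltnNge => lN.
    suff ue : u N t = step (transform_coef b) t.
      by rewrite -/(u N t) ue subrr normr0.
    rewrite (step_cell _ lt) -(transform_coefE _ lN); apply: eq_bigr => m _.
    congr (_ - _); first exact: step_condE.
    by case: m.*2 => [|k]//=; exact: step_condE.
rewrite (measureU0 (mu := @lebesgue_measure R) mI mQ Q0).
have IE : lebesgue_measure (`[0, 2 ^- N]%classic : set R) = (2 ^- N)%:E.
  by rewrite lebesgue_measure_itv/= lte_fin pow2N_gt0 -EFinB subr0.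
by rewrite -[leRHS]IE; exact: lexx.
Qed.

Lemma rearrangement_step_lb (R : realType) (c : nat -> R) (l : nat) (t : R) :
  0 < t -> t < 2 ^- l.+1 -> c l <= rearrangement (step c) t.
Proof.
move=> t0 tl; apply: rearrangement_lb => //; first exact: measurable_step01.
move=> s s0 sl; apply: (@lt_le_trans _ _ (lebesgue_measure (cell R l))).
  rewrite /cell lebesgue_measure_itv/= lte_fin ltr_pow2N ltnSn -EFinB lte_fin.
  by have := pow2NS R l; lra.
apply: le_measure; rewrite ?inE; first exact: measurable_cell.
  by apply: measurable_superlevel; exact: measurable_step01.
move=> u lu; split => /=.
  rewrite in_itv/= (ltW (cell_gt0 lu)).
  by move: lu; rewrite cellE => /andP[_ /le_trans]; apply; exact: pow2N_le1.
by rewrite (step_cell _ lu) (lt_le_trans sl)// ler_norm.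
Qed.

(** When b vanishes at odd indices, A_{2m-1} = A_{2m} / 2, so each difference of
index 1 <= m <= p on the shell number 2p contributes A_{2m} / 2; the difference of
index 0 is A_0, which is at least A_0 / 2. *)
Lemma transform_coef_even (R : realType) (b : nat -> R) (p : nat) :
  L1 (step b) -> (forall j, 0 <= b j) -> (forall j, odd j -> b j = 0) ->
  2^-1 * \sum_(m < p.+1) dyadic_mean b m.*2 <= transform_coef b p.*2.
Proof.
move=> b1 b0 bodd; rewrite /transform_coef (big_cat_nat (n := p.+1))//=; last by lia.
rewrite [X in _ + X]big_nat_cond [X in _ + X]big1 ?addr0; last first.
  move=> m; rewrite andbT => /andP[pm _]; have -> : m.*2 = (m.*2.-1).+1 by lia.
  rewrite /= /cond_coef !ifN ?subrr//; lia.
rewrite big_mkord mulr_sumr; apply: ler_sum => -[m /= mp] _.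
have M0 n : 0 <= dyadic_mean b n by exact: dyadic_mean_ge0.
case: m mp => [|m] mp; first by rewrite double0 /= /cond_coef leq0n subr0
  ler_piMl// invf_le1// ler1n.
rewrite doubleS /= /cond_coef !ifT; [|lia|lia].
rewrite (dyadic_meanS (m.*2.+1) b1) bodd; last by rewrite /= odd_double.
by lra.
Qed.

(** * Comparison with the Calderon operator *)

Lemma ler_sum_widen (R : realType) (F : nat -> R) (m n : nat) :
  (forall j, 0 <= F j) -> (m <= n)%N -> \sum_(j < m) F j <= \sum_(j < n) F j.
Proof.
move=> F0 /subnKC <-; rewrite big_split_ord/= lerDl.
by apply: sumr_ge0.
Qed.

(** The values of y at the left endpoints of the shells; if y is nonincreasing,
[step (majorant y)] dominates it on ]0, 1]. *)
Definition majorant (R : realType) (y : R -> R) (j : nat) : R := y (2 ^- j.+1).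

(** The coefficients of the function f. *)
Definition even_coef (R : realType) (y : R -> R) (j : nat) : R :=
  if odd j then 0 else 3 * y (2 ^- j.+2).

Lemma majorant_ge0 (R : realType) (y : R -> R) (j : nat) :
  (forall t, 0 <= y t) -> 0 <= majorant y j.
Proof. exact. Qed.

Lemma even_coef_ge0 (R : realType) (y : R -> R) (j : nat) :
  (forall t, 0 <= y t) -> 0 <= even_coef y j.
Proof. by move=> y0; rewrite /even_coef; case: ifP => // _; rewrite mulr_ge0. Qed.

Lemma L1_step_majorant (R : realType) (y : R -> R) (M : R) :
  (forall t, 0 <= y t) -> (forall N, \sum_(k < N) y (2 ^- k) * 2 ^- k <= M) ->
  L1 (step (majorant y)).
Proof.
move=> y0 yM; apply: (@integrable_step _ _ M); first by move=> j; exact: majorant_ge0.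
move=> N; apply: le_trans (yM N.+1); rewrite big_ord_recl/= lerDr.
by rewrite mulr_ge0// ltW ?pow2N_gt0.
Qed.

Lemma L1_step_even_coef (R : realType) (y : R -> R) (M : R) :
  (forall t, 0 <= y t) -> (forall N, \sum_(k < N) y (2 ^- k) * 2 ^- k <= M) ->
  L1 (step (even_coef y)).
Proof.
move=> y0 yM; apply: (@integrable_step _ _ (6 * M)).
  by move=> j; exact: even_coef_ge0.
move=> N; apply: le_trans (_ : _ <= 6 * (\sum_(k < N.+2) y (2 ^- k) * 2 ^- k)) _;
  last first.
  by rewrite ler_pM2l// yM.
have p k : 0 <= y (2 ^- k) * 2 ^- k by rewrite mulr_ge0// ltW ?pow2N_gt0.
rewrite 2!big_ord_recl/= !mulrDr addrA -[leLHS]add0r lerD//.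
  by rewrite addr_ge0// mulr_ge0// mulr_ge0// ltW ?pow2N_gt0.
rewrite mulr_sumr; apply: ler_sum => j _.
rewrite /even_coef /bump/= !add1n; have := p j.+2; have := pow2NS R j.+1.
move=> e pj; case: ifP => _; first by rewrite mul0r mulr_ge0.
by rewrite e; lra.
Qed.

(** Grouping the shells 2i and 2i+1, of lengths 2h and h with h = 2^-(2i+2), the
majorant integrates to at most 3 h y(h), and f to 6 h y(h). *)
Lemma dyadic_mean_majorant (R : realType) (y : R -> R) (q : nat) :
  (forall t, 0 <= y t) -> (forall s t, 0 < s -> s <= t -> y t <= y s) ->
  L1 (step (even_coef y)) ->
  dyadic_mean (majorant y) q.*2 <= 2^-1 * dyadic_mean (even_coef y) q.*2.
Proof.
move=> y0 ymono b1; rewrite /dyadic_mean mulrCA ler_pM2l ?exprn_gt0//.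
have c0 j : 0 <= majorant y j by exact: majorant_ge0.
have b0 j : 0 <= even_coef y j by exact: even_coef_ge0.
apply: step_integral_ub => // k.
have le2k : (k <= k.*2)%N by lia.
pose F j := majorant y (q.*2 + j)%N * 2 ^- (q.*2 + j).+1.
apply: le_trans (ler_sum_widen (F := F) _ le2k) _.
  by move=> j; rewrite mulr_ge0// ltW ?pow2N_gt0.
apply: le_trans (_ : _ <= 2^-1 * \sum_(j < k.*2)
    even_coef y (q.*2 + j)%N * 2 ^- (q.*2 + j).+1) _; last first.
  by rewrite ler_pM2l ?invr_gt0//; exact: step_integral_lb.
rewrite {}/F; elim: {le2k} k => [|k IH]; first by rewrite !big_ord0 mulr0.
rewrite doubleS !big_ord_recr/= !mulrDr -!addrA; apply: lerD => //.
set e := (q.*2 + k.*2)%N.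
have -> : (q.*2 + k.*2.+1 = e.+1)%N by rewrite addnS.
rewrite /majorant /even_coef.
have -> : odd e = false by rewrite oddD !odd_double.
have -> : odd e.+1 = true by rewrite /= oddD !odd_double.
have yy : y (2 ^- e.+1) <= y (2 ^- e.+2).
  by apply: ymono; rewrite ?pow2N_gt0// ler_pow2N.
have h0 := pow2N_gt0 R e.+2.
(* all the lengths are expressed in terms of h = 2^-(e+2) *)
rewrite (pow2NS R e.+1) in yy *.
have : y (2 * 2 ^- e.+2) * 2 ^- e.+2 <= y (2 ^- e.+2) * 2 ^- e.+2.
  by rewrite ler_pM2r.
lra.
Qed.

Lemma even_coef_le_mean (R : realType) (y : R -> R) (q : nat) :
  (forall t, 0 <= y t) -> L1 (step (even_coef y)) ->
  3 * y (2 ^- q.*2.+2) <= 2 * dyadic_mean (even_coef y) q.*2.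
Proof.
move=> y0 b1; rewrite (dyadic_meanS _ b1) {1}/even_coef odd_double.
have : 0 <= dyadic_mean (even_coef y) q.*2.+1.
  by apply: dyadic_mean_ge0 => j; exact: even_coef_ge0.
lra.
Qed.

(** On the shell number j, y(u)/u is at most 2^(j+1) y(2^-(j+1)), and the shell
has length 2^-(j+1). *)
Lemma calderon_tail_le (R : realType) (y : R -> R) (r : nat) (s : R) :
  (forall t, 0 <= y t) -> (forall s t, 0 < s -> s <= t -> y t <= y s) ->
  2 ^- r.+1.*2 <= s ->
  \int[lebesgue_measure]_(u in `[s, 1]) (y u / u) <=
    \sum_(j < r.+1.*2) y (2 ^- j.+1).
Proof.
move=> y0 ymono rs; set n := r.+1.*2 in rs *.
pose d j : R := if (j < n)%N then y (2 ^- j.+1) * 2 ^+ j.+1 else 0.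
have d0 j : 0 <= d j.
  by rewrite /d; case: ifP => // _; rewrite mulr_ge0// exprn_ge0.
have dS k : \sum_(j < k) d j * 2 ^- j.+1 <= \sum_(j < n) y (2 ^- j.+1).
  have le1 : (k <= n + k)%N by rewrite leq_addl.
  apply: le_trans (ler_sum_widen (F := fun j => d j * 2 ^- j.+1) _ le1) _.
    by move=> j; rewrite mulr_ge0// ltW ?pow2N_gt0.
  rewrite big_split_ord/= [X in _ + X]big1 ?addr0.
    apply: ler_sum => j _; rewrite /d ltn_ord mulfK// expf_neq0.
  by move=> j _; rewrite /d ltnNge leq_addr/= mul0r.
have d1 : L1 (step d) by exact: integrable_step dS.
have s0 : 0 < s by apply: lt_le_trans rs; exact: pow2N_gt0.
apply: (@le_trans _ _ (step_integral d 0)); last exact: step_integral_ub.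
apply: Rintegral_le_step => //.
- exact: ltW.
- by rewrite expr0 invr1.
- apply: measurable_nonincreasing01 => u v u0 uv.
  have v0 := lt_le_trans u0 uv.
  apply: ler_pM; rewrite ?invr_ge0 ?(ltW v0)//; first exact: ymono.
  by rewrite lef_pV2.
- move=> u su u1; have u0 := lt_trans s0 su.
  rewrite divr_ge0 ?(ltW u0)//=.
  have [j ju] := cell_exists u0 u1; rewrite (step_cell _ ju).
  move: (ju); rewrite cellE => /andP[/ltW ju1 uj].
  have jn : (j < n)%N.
    by rewrite -(ltr_pow2N R); apply: lt_le_trans uj; exact: le_lt_trans su.
  rewrite /d jn; apply: ler_pM => //; first by rewrite invr_ge0 ltW.
    by apply: ymono => //; exact: pow2N_gt0.
  by rewrite -[leRHS]invrK lef_pV2 ?posrE ?pow2N_gt0.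
Qed.

Lemma calderon_le (R : realType) (y : R -> R) (r : nat) (s : R) :
  (forall t, 0 <= y t) -> (forall s t, 0 < s -> s <= t -> y t <= y s) ->
  L1 (step (majorant y)) -> L1 (step (even_coef y)) ->
  2 ^- r.+1.*2 <= s -> s <= 2 ^- r.*2 ->
  calderon y s <= 4 * \sum_(q < r.+1) dyadic_mean (even_coef y) q.*2.
Proof.
move=> y0 ymono c1 b1 rs sr; rewrite /calderon.
have M0 q : 0 <= dyadic_mean (even_coef y) q.
  by apply: dyadic_mean_ge0 => j; exact: even_coef_ge0.
have s0 : 0 < s by apply: lt_le_trans rs; exact: pow2N_gt0.
have I1 : \int[lebesgue_measure]_(u in `[0, s]) y u <= step_integral (majorant y) r.*2.
  apply: Rintegral_le_step => //.
  - exact: measurable_nonincreasing01.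
  - by move=> j; exact: majorant_ge0.
  - move=> t t0 ts; rewrite y0/=.
    have t1 : t <= 1 by rewrite (le_trans ts)// (le_trans sr)// pow2N_le1.
    have [j jt] := cell_exists t0 t1; rewrite (step_cell _ jt).
    move: jt; rewrite cellE => /andP[/ltW jt _].
    by apply: ymono => //; exact: pow2N_gt0.
have I2 : s^-1 * (\int[lebesgue_measure]_(u in `[0, s]) y u) <=
    4 * dyadic_mean (majorant y) r.*2.
  rewrite /dyadic_mean mulrA; apply: ler_pM => //.
  - by rewrite invr_ge0 ltW.
  - exact: Rintegral_ge0.
  - rewrite -[leRHS]invrK lef_pV2 ?posrE// ?invr_gt0 ?mulr_gt0 ?exprn_gt0//.
    apply: le_trans rs; rewrite doubleS !exprS.
    by rewrite (mulrA 2 2) -natrM.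
have I3 := dyadic_mean_majorant r y0 ymono b1.
have I4 : \int[lebesgue_measure]_(u in `[s, 1]) (y u / u) <=
    2 * \sum_(q < r.+1) dyadic_mean (even_coef y) q.*2.
  apply: le_trans (calderon_tail_le y0 ymono rs) _.
  elim: (r.+1) => [|k IH]; first by rewrite !big_ord0 mulr0.
  rewrite doubleS !big_ord_recr/= mulrDr -addrA; apply: lerD => //.
  have : y (2 ^- k.*2.+1) <= y (2 ^- k.*2.+2).
    by apply: ymono; rewrite ?pow2N_gt0// ler_pow2N.
  have := even_coef_le_mean k y0 b1; have := y0 (2 ^- k.*2.+2); lra.
have : dyadic_mean (even_coef y) r.*2 <= \sum_(q < r.+1) dyadic_mean (even_coef y) q.*2.
  by rewrite big_ord_recr/= lerDr; apply: sumr_ge0.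
lra.
Qed.

Lemma step_even_coef_le (R : realType) (y : R -> R) (t : R) :
  (forall t, 0 <= y t) -> (forall s t, 0 < s -> s <= t -> y t <= y s) ->
  0 <= t <= 1 -> `|step (even_coef y) t| <= 3 * dilation 4 y t.
Proof.
move=> y0 ymono /andP[t0 t1].
rewrite ger0_norm; last by apply: step_ge0 => j; exact: even_coef_ge0.
rewrite /dilation indicE mem_set ?mulr1; last by rewrite /= in_itv/=; lra.
move: t0; rewrite le_eqVlt => /predU1P[<-|t0].
  by rewrite /step ltxx mulr_ge0.
have [j jt] := cell_exists t0 t1; rewrite (step_cell _ jt) /even_coef.
case: ifP => _; first by rewrite mulr_ge0.
rewrite ler_pM2l//; apply: ymono; first by rewrite divr_gt0.
move: jt; rewrite cellE (pow2NS R j) (pow2NS R j.+1) => /andP[_ ?]; lra.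
Qed.

Theorem theorem1 (R : realType) (x : R -> R) (hx : L1 x) :
  exists f : R -> R,
    [/\ L1 f,
        ae_le (fun t => `|f t|) (fun t => 3 * dilation 4 (rearrangement x) t) &
        exists2 Tf : R -> R, is_martingale_transform f Tf &
          ae_le (dilation 8^-1 (calderon (rearrangement x)))
                (fun t => 12 * rearrangement Tf t)].
Proof.
have mx := L1_measurable hx.
have [M yM] := rearrangement_summable hx.
set y := rearrangement x in yM *.
have y0 t : 0 <= y t by exact: rearrangement_ge0.
have ymono s t : 0 < s -> s <= t -> y t <= y s.
  by move=> s0 st; exact: rearrangement_nonincreasing.
have c1 := L1_step_majorant y0 yM; have b1 := L1_step_even_coef y0 yM.
set b := even_coef y in b1.
have b0 j : 0 <= b j by exact: even_coef_ge0.
exists (step b); split => //.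
  by apply: aeW => t; rewrite in_itv/=; exact: step_even_coef_le.
exists (step (transform_coef b)); first exact: is_martingale_transform_step.
exists (\bigcup_n dyadic_points R n); split.
- exact: measurable_dyadic_points.
- by apply: countable_lebesgue_measure0; exact: countable_dyadic_points.
move=> t /= tn; apply: contrapT => tQ; apply: tn; rewrite in_itv/= => /andP[t0' t1].
have t0 : 0 < t.
  rewrite lt_neqAle t0' andbT; apply/eqP => te; apply: tQ; exists 0%N => //.
  by exists 0%N; rewrite -te mul0r.
rewrite /dilation invrK indicE; case: (boolP (_ \in _)); last first.
  by rewrite mulr0 mulr_ge0// rearrangement_ge0.
move=> /set_mem; rewrite /= in_itv/= mulr1 => /andP[_ s1].
set s := t * 8 in s1 *.
(* r is chosen so that 4^-(r+1) <= s <= 4^-r *)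
have s0 : 0 < s by rewrite mulr_gt0.
have [l ls] := cell_exists s0 s1; set r := l./2.
have rl : (r.*2 <= l)%N by rewrite /r; lia.
have lr : (l < r.+1.*2)%N by rewrite /r; lia.
have sr : s <= 2 ^- r.*2 by rewrite (cell_le _ ls).
have rs : 2 ^- r.+1.*2 <= s.
  move: ls; rewrite cellE => /andP[/ltW ls _].
  by apply: le_trans ls; rewrite ler_pow2N.
have tr : t < 2 ^- r.+1.*2.+1.
  have e : 2 ^- r.*2 = 8 * 2 ^- r.+1.*2.+1 :> R.
    by rewrite (pow2NS R r.*2) (pow2NS R r.*2.+1) (pow2NS R r.*2.+2) doubleS; lra.
  have te : t != 2 ^- r.+1.*2.+1.
    apply/eqP => te; apply: tQ; exists r.+1.*2.+1 => //.
    by exists 1%N; rewrite mul1r.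
  by rewrite lt_neqAle te/=; move: sr; rewrite e /s; lra.
have I1 := calderon_le y0 ymono c1 b1 rs sr.
have I2 := rearrangement_step_lb (transform_coef b) t0 tr.
have I3 : 2^-1 * \sum_(m < r.+2) dyadic_mean b m.*2 <= transform_coef b r.+1.*2.
  apply: transform_coef_even => // j jo.
  by rewrite /b /even_coef jo.
have W0 : 0 <= \sum_(q < r.+1) dyadic_mean b q.*2.
  by apply: sumr_ge0 => q _; exact: dyadic_mean_ge0.
have M0 : 0 <= dyadic_mean b r.+1.*2 by exact: dyadic_mean_ge0.
move: I3; rewrite big_ord_recr/= => I3.
rewrite -/b in I1.
lra.
Qed.
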